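(* Let $K$ be a field, let $r,s$ be non negative integers, and let $I(T_{r,s})=(ab,\ ax_1,\dots,ax_r,\ by_1,\dots,by_s)$ be the edge ideal of the double-star graph $T_{r,s}$ in $R=K[a,b,x_1,\dots,x_r,y_1,\dots,y_s]$. Then $\mathrm{pd}\,I(T_{r,s})=\max\{r,s\}+1$. Moreover, for all $t=1,\dots,\mathrm{pd}\,I(T_{r,s})$, the $t$-th Betti number of $I(T_{r,s})$ is $$\beta_t=\begin{cases}1+r+s & \text{if } t=1,\\[2pt] \binom{r+1}{t}+\binom{s+1}{t} & \text{if } 2\le t\le \mathrm{pd}\,I(T_{r,s}),\end{cases}$$ where all binomial coefficients $\binom{p}{q}$ with $p<q$ are set equal to zero.
   Context: The double-star graph $T_{r,s}$ is the tree on the distinct vertices $a,b,x_1,\dots,x_r,y_1,\dots,y_s$ with edges $\{a,b\}$, $\{a,x_i\}$ ($1\le i\le r$), $\{b,y_i\}$ ($1\le i\le s$). Conventions: $\mathrm{pd}\,I$ denotes the length of every minimal free resolution of the quotient $R/I$ over $R$, and the $t$-th Betti number $\beta_t$ of $I$ is the rank of the free module in homological degree $t$ of a minimal free resolution of $R/I$ (so $\beta_1$ is the minimal number of generators of $I$). *)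

(* Defs.v *)
From HB Require Import structures.
From mathcomp Require Import all_boot all_order all_algebra.
From mathcomp Require Import mpoly.
Set Implicit Arguments.
Unset Strict Implicit.
Unset Printing Implicit Defensive.
Import GRing.Theory.
Local Open Scope ring_scope.

Definition generated_ideal (R : comNzRingType) (gs : seq R) (p : R) : Prop :=
  exists c : 'I_(size gs) -> R, p = \sum_i c i * gs`_i.

(* A sequence of finite free modules R^(rk 0) <- R^(rk 1) <- R^(rk 2) <- ...
   whose maps act on row vectors by right multiplication.  An R-linear map
   R^(rk 0) -> R/I sends the j-th basis vector to the class of some element of
   R, so it is encoded by a column [aug] of such representatives: it is
   v |-> v *m aug modulo I.  No map is assumed to compose to zero here. *)
Record free_sequence (R : comNzRingType) := FreeSequence {
  rk : nat -> nat;
  diff : forall t, 'M[R]_(rk t.+1, rk t);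
  aug : 'cV[R]_(rk 0) }.

Section FreeSequences.

Variables (R : comNzRingType) (I : R -> Prop) (F : free_sequence R).

(* Exactness of ... -> F_2 -> F_1 -> F_0 -> R/I -> 0. *)
Definition free_resolution : Prop :=
  [/\ forall p : R, exists v : 'rV[R]_(rk F 0), I ((v *m aug F) 0 0 - p),
      forall v : 'rV[R]_(rk F 0),
        I ((v *m aug F) 0 0) <->
        exists w : 'rV[R]_(rk F 1), v = w *m diff F 0
    & forall t (v : 'rV[R]_(rk F t.+1)),
        v *m diff F t = 0 <->
        exists w : 'rV[R]_(rk F t.+2), v = w *m diff F t.+1].

(* A finite resolution is one whose modules are eventually zero. *)
Definition has_length (l : nat) : Prop :=
  (0 < rk F l)%N /\ forall t, (l < t)%N -> rk F t = 0%N.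

End FreeSequences.

Section Minimality.

Variables (K : fieldType) (n : nat).
Implicit Types (I : {mpoly K[n]} -> Prop) (F : free_sequence {mpoly K[n]}).

Definition irrelevant_ideal : {mpoly K[n]} -> Prop :=
  generated_ideal [seq 'X_i | i <- enum 'I_n].

(* Free resolution of R/I with d(F_(t+1)) contained in (X_1,...,X_n) F_t. *)
Definition minimal_free_resolution I F : Prop :=
  free_resolution I F /\
  forall t i j, irrelevant_ideal (diff F t i j).

Definition homogeneous_of_degree (p : {mpoly K[n]}) (e : int) : Prop :=
  p = 0 \/ exists2 d : nat, e = d%:Z & p \is d.-homog.

(* F_t is the direct sum of the R(- deg t j), and all maps have degree 0. *)
Definition graded F : Prop :=
  exists deg : forall t, 'I_(rk F t) -> int,
    (forall j, homogeneous_of_degree (aug F j 0) (deg 0 j)) /\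
    (forall t i j,
       homogeneous_of_degree (diff F t i j) (deg t.+1 i - deg t j)).

(* The two invariants below are relations, "pd I is l" and "beta_t(I) is m":
   a graded minimal free resolution of R/I exists, and every minimal free
   resolution of R/I (graded or not) has the given length or rank.  Both
   concern the quotient R/I, not the module I. *)
Definition projective_dimension I (l : nat) : Prop :=
  (exists2 F, minimal_free_resolution I F & graded F) /\
  forall F, minimal_free_resolution I F -> has_length F l.

Definition betti_number I (t m : nat) : Prop :=
  (exists2 F, minimal_free_resolution I F & graded F) /\
  forall F, minimal_free_resolution I F -> rk F t = m.

(* The edge ideal of the graph on 'I_n given by its list of edges. *)
Definition edge_ideal (E : seq ('I_n * 'I_n)) : {mpoly K[n]} -> Prop :=
  generated_ideal [seq 'X_(e.1) * 'X_(e.2) | e <- E].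

End Minimality.

Arguments edge_ideal K {n} E.

Section DoubleStar.

Variables r s : nat.

(* The vertices a, b, x_1, ..., x_r, y_1, ..., y_s, in this order. *)
Definition va : 'I_(2 + (r + s)) := lshift (r + s) (ord0 : 'I_2).
Definition vb : 'I_(2 + (r + s)) := lshift (r + s) (ord_max : 'I_2).
Definition vx (i : 'I_r) : 'I_(2 + (r + s)) := rshift 2 (lshift s i).
Definition vy (j : 'I_s) : 'I_(2 + (r + s)) := rshift 2 (rshift r j).

Definition double_star : seq ('I_(2 + (r + s)) * 'I_(2 + (r + s))) :=
  (va, vb) :: [seq (va, vx i) | i <- enum 'I_r]
           ++ [seq (vb, vy j) | j <- enum 'I_s].

End DoubleStar.

(* Main.v *)
Require Import Defs.
From HB Require Import structures.
From mathcomp Require Import all_boot all_order all_algebra.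
From mathcomp Require Import mpoly.
Set Implicit Arguments.
Unset Strict Implicit.
Unset Printing Implicit Defensive.
Import GRing.Theory.
Local Open Scope ring_scope.


(** Write [X] for the ideal of the variables [b, x_1, ..., x_r] and [Y] for
    the ideal of the variables [a, y_1, ..., y_s].  The edge ideal is
    [I = a X + b Y], and since [a] and [b] are coprime, the two summands meet
    exactly in the multiples of [ab]:

      0 -> R(-2) -> a X (+) b Y -> I -> 0.

    [a X] and [b Y] are isomorphic to [X] and [Y], which are resolved by
    truncated Koszul complexes, with [C(r+1, t)] and [C(s+1, t)] generators in
    homological degree [t].  The only defect of the direct sum of these two
    complexes is that the generator [ab] is present twice, once as [a * b] and
    once as [b * a].  Identifying these two basis vectors in degree 1, and
    changing nothing in higher degrees, gives a resolution of [I] ([glue],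
    [glue_exact]).  It is linear: the generators are quadrics and all further
    matrices have linear entries.  Hence it is graded and minimal, and its
    ranks are [1 + r + s] and then [C(r+1, t) + C(s+1, t)].

    Koszul complexes are built as iterated mapping cones ([cone],
    [cone_exact]), so that their ranks satisfy the Pascal recursion; adding a
    variable preserves exactness because it is a nonzerodivisor modulo the
    ideal of the other variables ([vars_ideal_nzd]).

    It remains to see that an arbitrary minimal free resolution, graded or not,
    has the same ranks ([minimal_rank_unique]).  Two resolutions of the same
    quotient are related by chain maps inverse to each other up to homotopy;
    for a minimal resolution the homotopy terms vanish at the origin, so that
    over the residue field the chain maps become honestly inverse
    ([rank_minimal_le]). *)

(** * Finitely generated ideals *)

Section GeneratedIdeals.
Variable R : comNzRingType.
Implicit Types (gs : seq R) (p q : R).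

Lemma generated_ideal_nil p : generated_ideal [::] p <-> p = 0.
Proof.
split=> [[c ->]|->]; first by rewrite big_ord0.
by exists (fun=> 0); rewrite big_ord0.
Qed.

Lemma generated_ideal_cons g gs p :
  generated_ideal (g :: gs) p <-> exists c, generated_ideal gs (p - c * g).
Proof.
split=> [[c ->]|[c [d /eqP]]].
  exists (c ord0); exists (fun i => c (lift ord0 i)).
  by rewrite big_ord_recl /= addrAC subrr add0r.
rewrite subr_eq addrC => /eqP ->.
exists (fun i => oapp d c (unlift ord0 i)).
by rewrite big_ord_recl unlift_none; congr (_ + _); apply: eq_bigr => i _; rewrite liftK.
Qed.

Lemma generated_ideal0 gs : generated_ideal gs 0.
Proof. by exists (fun=> 0); rewrite big1 // => i _; rewrite mul0r. Qed.

Lemma generated_idealD gs p q :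
  generated_ideal gs p -> generated_ideal gs q -> generated_ideal gs (p + q).
Proof.
case=> [c ->] [d ->]; exists (fun i => c i + d i).
by rewrite -big_split; apply: eq_bigr => i _; rewrite mulrDl.
Qed.

Lemma generated_idealM gs p q :
  generated_ideal gs q -> generated_ideal gs (p * q).
Proof.
case=> [c ->]; exists (fun i => p * c i).
by rewrite mulr_sumr; apply: eq_bigr => i _; rewrite mulrA.
Qed.

Lemma generated_ideal_sum gs (T : finType) (f : T -> R) :
  (forall i, generated_ideal gs (f i)) -> generated_ideal gs (\sum_i f i).
Proof.
move=> gsf; apply: big_ind => //; first exact: generated_ideal0.
exact: generated_idealD.
Qed.

Lemma generated_ideal_mulmx gs m k (A : 'M[R]_(m, k)) (B : 'cV[R]_k) :
  (forall i, generated_ideal gs (B i 0)) ->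
  forall i, generated_ideal gs ((A *m B) i 0).
Proof.
move=> gsB i; rewrite mxE; apply: generated_ideal_sum => j.
exact: generated_idealM.
Qed.

Lemma generated_ideal_cat gs hs p :
  generated_ideal (gs ++ hs) p <->
  exists2 q, generated_ideal gs q & generated_ideal hs (p - q).
Proof.
elim: gs p => [|g gs IH] p.
  split=> [hp|[q /generated_ideal_nil ->]]; last by rewrite subr0.
  by exists 0; [exact: generated_ideal0 | rewrite subr0].
rewrite [_ ++ _]/=; split=> [/generated_ideal_cons [c /IH [q gq hq]]|[q]].
  exists (q + c * g); last by rewrite opprD [- q + _]addrC addrA.
  by apply/generated_ideal_cons; exists c; rewrite addrK.
case/generated_ideal_cons => c gq hq; apply/generated_ideal_cons; exists c.
apply/IH; exists (q - c * g) => //.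
by rewrite opprB addrA subrK.
Qed.

Lemma generated_ideal_scale a gs p :
  generated_ideal [seq a * g | g <- gs] p <->
  exists2 q, generated_ideal gs q & p = a * q.
Proof.
elim: gs p => [|g gs IH] p.
  split=> [/generated_ideal_nil ->|[q /generated_ideal_nil -> ->]].
    by exists 0; [exact: generated_ideal0 | rewrite mulr0].
  by rewrite mulr0; exact: generated_ideal0.
rewrite [map _ _]/=; split=> [/generated_ideal_cons [c /IH [q gq qE]]|[q]].
  exists (q + c * g); last by rewrite mulrDr -qE mulrCA subrK.
  by apply/generated_ideal_cons; exists c; rewrite addrK.
case/generated_ideal_cons => c gq ->; apply/generated_ideal_cons; exists c.
by apply/IH; exists (q - c * g) => //; rewrite mulrBr mulrCA.
Qed.

End GeneratedIdeals.

(** * Uniqueness of the ranks of a minimal resolution *)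

Section Comparison.
Variables (R : comNzRingType) (gs : seq R).
Implicit Types F G : free_sequence R.

(** The rows of [V] are cycles of [F] in homological degree [t]; in degree 0
    this means that they are mapped into the ideal.  Treating degree 0 on the
    same footing lets one induction build chain maps and homotopies. *)
Definition cycle_mx F t : forall m, 'M[R]_(m, rk F t) -> Prop :=
  match t with
  | 0 => fun m V => forall i : 'I_m, generated_ideal gs ((V *m aug F) i 0)
  | u.+1 => fun m V => V *m diff F u = 0
  end.

Lemma cycle_mxP F t m (V : 'M[R]_(m, rk F t)) :
  free_resolution (generated_ideal gs) F ->
  cycle_mx V <-> exists W : 'M[R]_(m, rk F t.+1), V = W *m diff F t.
Proof.
case=> _ ex0 exS.
have exrow (v : 'rV_(rk F t)) :
    cycle_mx v <-> exists w : 'rV_(rk F t.+1), v = w *m diff F t.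
  case: t {V} v => [|t] v /=; last exact: exS.
  rewrite -ex0; split=> [/(_ 0) //|cv i]; by rewrite ord1.
have -> : cycle_mx V <-> forall i, cycle_mx (row i V).
  case: t {exrow} V => [|t] V /=.
    by split=> cV i; [move=> j|have := cV i 0];
      rewrite -row_mul mxE.
  split=> [V0 i|V0]; first by rewrite -row_mul V0 row0.
  by apply/row_matrixP => i; rewrite row_mul V0 row0.
split=> [cV|[W ->] i]; last by apply/exrow; exists (row i W); rewrite row_mul.
have /fin_all_exists [w wP] : forall i,
    exists w : 'rV_(rk F t.+1), row i V = w *m diff F t.
  by move=> i; apply/exrow.
exists (\matrix_i w i); apply/row_matrixP => i.
by rewrite row_mul rowK.
Qed.

Lemma cycle_mx_diff F t :
  free_resolution (generated_ideal gs) F -> cycle_mx (diff F t).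
Proof. by move=> resF; apply/cycle_mxP => //; exists 1%:M; rewrite mul1mx. Qed.

Lemma aug_lift F G :
  free_resolution (generated_ideal gs) G ->
  exists phi : 'M[R]_(rk F 0, rk G 0),
    forall i, generated_ideal gs ((phi *m aug G - aug F) i 0).
Proof.
case=> surj _ _.
have /fin_all_exists [v vP] : forall i, exists v : 'rV_(rk G 0),
    generated_ideal gs ((v *m aug G) 0 0 - aug F i 0) by move=> i; apply: surj.
exists (\matrix_i v i) => i; have := vP i.
by rewrite -[v i](rowK v i) -row_mul mxE => vPi; rewrite !mxE in vPi *.
Qed.

(** If [ev] kills the differentials of [F], then [F] is at most as large as any
    other resolution [G]: with chain maps [phi : F -> G] and [psi : G -> F]
    lifting the identity, [1 - phi psi] is a sum of two terms each having a
    differential of [F] as a factor, so [ev phi] has the right inverse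
    [ev psi]. *)
Lemma rank_minimal_le (K : fieldType) (ev : {rmorphism R -> K}) F G t :
  free_resolution (generated_ideal gs) F ->
  free_resolution (generated_ideal gs) G ->
  (forall u, map_mx ev (diff F u) = 0) ->
  (rk F t <= rk G t)%N.
Proof.
move=> resF resG minF.
(* [e] stands for the part [diff o homotopy] of the relation
   [1 - phi psi = diff o homotopy + homotopy o diff].  Recording only that it
   vanishes under [ev] and on cycles, and that the rest of [1 - phi psi]
   consists of cycles, is enough to pass to the next degree, so that the chain
   maps need not be chosen simultaneously in all degrees. *)
have [phi [psi [e [[_ _ ev0 _] he]]]] :
  exists phi (psi : 'M_(rk G t, rk F t)) (e : 'M_(rk F t)),
    [/\ forall m (V : 'M_(m, rk F t)), cycle_mx V -> cycle_mx (V *m phi),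
        forall m (V : 'M_(m, rk G t)), cycle_mx V -> cycle_mx (V *m psi),
        map_mx ev e = 0
      & forall m (V : 'M_(m, rk F t)), cycle_mx V -> V *m e = 0]
    /\ cycle_mx (1%:M - phi *m psi - e).
  elim: t => [|t [phi [psi [e [[cphi cpsi _ ce] he]]]]].
    have [phi phiP] := aug_lift F resG; have [psi psiP] := aug_lift G resF.
    have lift_cycle A B (phi' : 'M_(rk A 0, rk B 0)) :
        (forall i, generated_ideal gs ((phi' *m aug B - aug A) i 0)) ->
        forall m (V : 'M_(m, rk A 0)), cycle_mx V -> cycle_mx (V *m phi').
      move=> phi'P m V cV i /=.
      rewrite -mulmxA -[phi' *m _](subrK (aug A)) mulmxDr mxE.
      by apply: generated_idealD; [apply: generated_ideal_mulmx | apply: cV].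
    exists phi, psi, 0; split.
      split=> [||| m V _]; [exact: lift_cycle | exact: lift_cycle | |].
        by rewrite map_mx0.
      by rewrite mulmx0.
    move=> i; rewrite subr0 mulmxBl mul1mx -mulmxA.
    have -> : aug F - phi *m (psi *m aug F) =
        -1 *: (phi *m (psi *m aug F - aug G) + (phi *m aug G - aug F)).
      by rewrite mulmxBr addrA subrK scaleN1r opprB.
    rewrite mxE; apply: generated_idealM; rewrite mxE.
    by apply: generated_idealD => //; apply: generated_ideal_mulmx.
  have cdF := cycle_mx_diff t resF; have cdG := cycle_mx_diff t resG.
  have /(cycle_mxP _ resG) [phi' phi'E] := cphi _ _ cdF.
  have /(cycle_mxP _ resF) [psi' psi'E] := cpsi _ _ cdG.
  have /(cycle_mxP _ resF) [h hE] := he.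
  exists phi', psi', (diff F t *m h); split.
    split=> [m V|m V||m V] /=.
    - by move=> V0; rewrite -mulmxA -phi'E mulmxA V0 mul0mx.
    - by move=> V0; rewrite -mulmxA -psi'E mulmxA V0 mul0mx.
    - by rewrite map_mxM minF mul0mx.
    - by move=> V0; rewrite mulmxA V0 mul0mx.
  rewrite /= !mulmxBl mul1mx -!mulmxA -hE -psi'E !mulmxBr mulmx1 ce //.
  by rewrite subr0 [phi' *m _]mulmxA -phi'E -mulmxA subrr.
have [h hE] := (cycle_mxP _ resF).1 he.
have evK : map_mx ev phi *m map_mx ev psi = 1%:M.
  rewrite -map_mxM; apply/esym/eqP; rewrite -subr_eq0 -(map_mx1 ev) -map_mxB.
  by rewrite -[1%:M - _ *m _](subrK e) hE map_mxD ev0 map_mxM minF mulmx0 addr0.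
rewrite -(mxrank1 K (rk F t)) -evK.
exact: leq_trans (mxrankM_maxl _ _) (rank_leq_col _).
Qed.

End Comparison.

(** * Mapping cones, gluing, and resolutions of ideals *)

Section IdealResolutions.
Variable R : comNzRingType.
Implicit Types F G : free_sequence R.

(** In this part a free sequence [F] is read as a sequence ending with
    [aug F : F_0 -> R], whose image is an ideal: it resolves the ideal rather
    than the quotient.  [prev_diff F t] is the map leaving [F_t], whether it is
    the augmentation or a differential. *)
Definition prev_rk F t := if t is u.+1 then rk F u else 1%N.

Definition prev_diff F t : 'M[R]_(rk F t, prev_rk F t) :=
  match t with 0 => aug F | u.+1 => diff F u end.

Definition aug_image F (p : R) : Prop :=
  exists v : 'rV[R]_(rk F 0), p%:M = v *m aug F.

Definition exact_sequence F : Prop :=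
  forall t (v : 'rV[R]_(rk F t)),
    v *m prev_diff F t = 0 <-> exists w : 'rV[R]_(rk F t.+1), v = w *m diff F t.

Lemma exact_sequence_diff F t :
  exact_sequence F -> diff F t *m prev_diff F t = 0.
Proof.
move=> exF; apply/row_matrixP => i; rewrite row_mul row0.
by apply/exF; exists (delta_mx 0 i); rewrite rowE.
Qed.

Definition nil_sequence : free_sequence R :=
  @FreeSequence R (fun=> 0%N) (fun=> 0) 0.

Lemma nil_sequence_exact : exact_sequence nil_sequence.
Proof.
move=> t v; split=> [_|_]; first by exists 0; apply/matrixP=> i [].
by apply/matrixP => i j; rewrite mxE big_ord0 mxE.
Qed.

(** The truncated mapping cone of multiplication by [x].  The new generator [x]
    is carried by the copy of [R] in [prev_rk F 0]; the sign makes two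
    consecutive matrices multiply to zero. *)
Definition cone (x : R) F : free_sequence R :=
  @FreeSequence R (fun t => rk F t + prev_rk F t)%N
    (fun t => block_mx (diff F t) 0 ((-1) ^+ t.+1 * x)%:M (prev_diff F t))
    (col_mx (aug F) x%:M).

Lemma cone_aug_image x F p :
  aug_image (cone x F) p <-> exists c, aug_image F (p - c * x).
Proof.
split=> [[v]|[c [w wE]]].
  rewrite -[v]hsubmxK mul_row_col [rsubmx v]mx11_scalar -scalar_mxM => pE.
  by exists (rsubmx v 0 0); exists (lsubmx v); rewrite raddfB /= pE addrK.
exists (row_mx w c%:M); rewrite mul_row_col -wE -scalar_mxM.
by rewrite -raddfD /= subrK.
Qed.

(** A cycle [[w, u]] of the cone has [u] a cycle of [F], with [x u] a boundary
    up to sign.  So [u] is a boundary: in degree 0 because [x] is a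
    nonzerodivisor modulo the ideal, higher up because [F] is exact.
    Subtracting the corresponding boundary of the cone reduces to a cycle of
    [F]. *)
Lemma cone_exact x F :
  exact_sequence F -> (forall p, aug_image F (x * p) -> aug_image F p) ->
  exact_sequence (cone x F).
Proof.
move=> exF regx t v.
have dd u : diff F u.+1 *m diff F u = 0 by exact: (exact_sequence_diff u.+1).
have d0 : diff F 0 *m aug F = 0 by exact: (exact_sequence_diff 0).
rewrite -[v]hsubmxK; move: (lsubmx v) (rsubmx v) => {v} w u.
case: t w u => [|t] w u /=.
  rewrite mul_row_col; split=> [eq0|[z]]; last first.
    rewrite -[z]hsubmxK mul_row_block mulmx0 add0r => /eq_row_mx [-> ->].
    rewrite mulmxDl -!mulmxA d0 mulmx0 add0r expr1 mulN1r mul_scalar_mx mul_mx_scalar.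
    by rewrite -mulmxDr -scalerDl addNr scale0r mulmx0.
  have [|u' u'E] := regx (u 0 0).
    exists (- w); rewrite mulNmx; apply/eqP; rewrite -addr_eq0 addrC.
    by rewrite mulrC scalar_mxM -mx11_scalar eq0.
  rewrite -mx11_scalar in u'E.
  have [|w' w'E] := (exF 0 (w + x *: u')).1.
    by rewrite /= mulmxDl -scalemxAl -u'E -mul_mx_scalar.
  exists (row_mx w' u').
  rewrite mul_row_block mulmx0 add0r -w'E -u'E expr1 mulN1r mul_mx_scalar.
  by rewrite scaleNr addrK.
rewrite mul_row_block mulmx0 add0r; set c := (-1) ^+ t.+1 * x.
have -> : (-1) ^+ t.+2 * x = - c by rewrite exprS mulN1r mulNr.
rewrite mul_mx_scalar; split=> [|[z]]; last first.
  rewrite -[z]hsubmxK mul_row_block mulmx0 add0r => /eq_row_mx [-> ->].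
  rewrite mulmxDl -!mulmxA dd (exact_sequence_diff t) // !mulmx0.
  by rewrite mul_scalar_mx scaleNr mulmxN -scalemxAr add0r addNr row_mx0.
rewrite -row_mx0 => /eq_row_mx [eq0 u0].
have [u' u'E] := (exF t u).1 u0.
have [|w' w'E] := (exF t.+1 (w + c *: u')).1.
  by rewrite /= mulmxDl -scalemxAl -u'E.
exists (row_mx w' u'); rewrite mul_row_block mulmx0 add0r -w'E -u'E.
by rewrite mul_mx_scalar scaleNr addrK.
Qed.

Section Glue.
Variables (a b : R) (F G : free_sequence R).

(** The resolution of [a * im (cone b F) + b * im (cone a G)] obtained from the
    direct sum of the two cones by identifying their last basis vectors in
    degree 0, which are both sent to [a * b].  The first block of degree 0 is
    the common vector; in [diff 0] the columns of the two cones are reordered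
    accordingly. *)
Definition glue : free_sequence R :=
  let CF := cone b F in let CG := cone a G in
  @FreeSequence R
    (fun t => if t is u.+1 then rk CF u.+1 + rk CG u.+1
              else 1 + (rk F 0 + rk G 0))%N
    (fun t => match t with
      | 0 => col_mx
          (row_mx (rsubmx (diff CF 0)) (row_mx (lsubmx (diff CF 0)) 0))
          (row_mx (rsubmx (diff CG 0)) (row_mx 0 (lsubmx (diff CG 0))))
      | u.+1 => block_mx (diff CF u.+1) 0 0 (diff CG u.+1)
      end)
    (col_mx (a * b)%:M (col_mx (a *: aug F) (b *: aug G))).

Lemma glue_aug_image p :
  aug_image glue p <->
  exists c q1 q2, [/\ aug_image F q1, aug_image G q2
    & p = c * (a * b) + (a * q1 + b * q2)].
Proof.
split=> [[v]|[c [q1 [q2 [[u1 q1E] [u2 q2E] ->]]]]].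
  rewrite -[v]hsubmxK -[rsubmx v]hsubmxK !mul_row_col => pE.
  exists (lsubmx v 0 0), ((lsubmx (rsubmx v) *m aug F) 0 0).
  exists ((rsubmx (rsubmx v) *m aug G) 0 0); split.
  - by exists (lsubmx (rsubmx v)); rewrite -mx11_scalar.
  - by exists (rsubmx (rsubmx v)); rewrite -mx11_scalar.
  have := congr1 (fun M : 'M_1 => M 0 0) pE.
  rewrite [lsubmx v]mx11_scalar -scalar_mxM -!scalemxAr.
  by rewrite !mxE /= !mulr1n.
exists (row_mx c%:M (row_mx u1 u2)); rewrite !mul_row_col -!scalemxAr.
by rewrite -q1E -q2E !scale_scalar_mx -scalar_mxM -!raddfD.
Qed.

Lemma mul_glue_diff0 (z1 : 'rV[R]_(rk (cone b F) 1)) (z2 : 'rV[R]_(rk (cone a G) 1)) :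
  let y1 : 'rV[R]_(rk F 0 + 1) := z1 *m diff (cone b F) 0 in
  let y2 : 'rV[R]_(rk G 0 + 1) := z2 *m diff (cone a G) 0 in
  (row_mx z1 z2 : 'rV_(rk glue 1)) *m diff glue 0 =
    row_mx (rsubmx y1 + rsubmx y2) (row_mx (lsubmx y1) (lsubmx y2)).
Proof.
move=> y1 y2; rewrite [LHS]mul_row_col !mul_mx_row !mulmx0.
by rewrite !mulmx_lsub !mulmx_rsub -/y1 -/y2 !add_row_mx addr0 add0r.
Qed.

(** In degree 0, a syzygy [a f + b g = 0] has [f = b q] and [g = - a q] by
    coprimality; moving [q] times the common basis vector from one cone to the
    other turns the syzygy into a pair of syzygies of the two cones.  In
    degree 1, if the images of a pair cancel in the common coordinate and vanish
    elsewhere, then that coordinate is annihilated by the nonzerodivisor [b]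
    (resp. [a]), so each image vanishes.  Above, the complex is a direct sum. *)
Lemma glue_exact :
  (forall p, a * p = 0 -> p = 0) -> (forall p, b * p = 0 -> p = 0) ->
  (forall p q, a * p = b * q -> exists c, p = b * c) ->
  exact_sequence (cone b F) -> exact_sequence (cone a G) ->
  exact_sequence glue.
Proof.
move=> rega regb coprime_ab exCF exCG.
have augCF (y : 'rV[R]_(rk F 0 + 1)) :
    y *m aug (cone b F) = lsubmx y *m aug F + b *: rsubmx y.
  by rewrite -{1}[y]hsubmxK [LHS]mul_row_col mul_mx_scalar.
have augCG (y : 'rV[R]_(rk G 0 + 1)) :
    y *m aug (cone a G) = lsubmx y *m aug G + a *: rsubmx y.
  by rewrite -{1}[y]hsubmxK [LHS]mul_row_col mul_mx_scalar.
have dF0 : diff (cone b F) 0 *m aug (cone b F) = 0 := exact_sequence_diff 0 exCF.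
have dG0 : diff (cone a G) 0 *m aug (cone a G) = 0 := exact_sequence_diff 0 exCG.
case=> [|[|t]] v; rewrite -[v]hsubmxK; move: (lsubmx v) (rsubmx v) => {v} w u.
- rewrite -[u]hsubmxK; move: (lsubmx u) (rsubmx u) => {u} u1 u2.
  rewrite [X in X = 0](_ : _ =
    a *: (u1 *m aug F + b *: w) + b *: (u2 *m aug G)); last first.
    rewrite /= !mul_row_col mul_mx_scalar -!scalemxAr scalerDr scalerA.
    by rewrite addrA (addrC (_ *: w)).
  split=> [eq0|[z]].
    have [|q qE] := coprime_ab ((u1 *m aug F + b *: w) 0 0) (- (u2 *m aug G) 0 0).
      have := congr1 (fun M : 'M_1 => M 0 0) eq0.
      by rewrite !mxE => /eqP; rewrite addr_eq0 mulrN => /eqP.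
    have q2E : (u2 *m aug G) 0 0 + a * q = 0.
      apply: regb; have := congr1 (fun M : 'M_1 => M 0 0) eq0.
      rewrite mxE [X in X + _]mxE qE [X in _ + X]mxE mulrDr mulrCA addrC => ->.
      by rewrite mxE.
    have [|z1 z1E] := (exCF 0 (row_mx u1 (w - q%:M))).1.
      rewrite [LHS]augCF row_mxKl row_mxKr scalerBr addrA.
      by rewrite [_ + _ *: w]mx11_scalar qE scale_scalar_mx subrr.
    have [|z2 z2E] := (exCG 0 (row_mx u2 q%:M)).1.
      rewrite [LHS]augCG row_mxKl row_mxKr scale_scalar_mx.
      by rewrite [_ *m _]mx11_scalar -raddfD /= q2E raddf0.
    exists (row_mx z1 z2); rewrite mul_glue_diff0 -z1E -z2E.
    by rewrite !row_mxKl !row_mxKr subrK.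
  rewrite -[z]hsubmxK mul_glue_diff0 => /eq_row_mx [-> /eq_row_mx [-> ->]].
  move: (lsubmx z) (rsubmx z) => {z} z1 z2; set y1 := z1 *m _; set y2 := z2 *m _.
  have y1_0 : lsubmx y1 *m aug F + b *: rsubmx y1 = 0.
    by rewrite -augCF -mulmxA dF0 mulmx0.
  have y2_0 : lsubmx y2 *m aug G + a *: rsubmx y2 = 0.
    by rewrite -augCG -mulmxA dG0 mulmx0.
  rewrite [b *: (_ + _)]scalerDr addrA y1_0 add0r scalerA mulrC -scalerA -scalerDr.
  by rewrite [_ + _ *m _]addrC y2_0 scaler0.
- rewrite [_ *m prev_diff _ _]mul_glue_diff0 [diff glue 1]/=.
  split=> [eq0|[z]]; last first.
    rewrite -[z]hsubmxK mul_row_block !mulmx0 add0r addr0 => /eq_row_mx [-> ->].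
    rewrite -!mulmxA.
    have -> : diff (cone b F) 1 *m diff (cone b F) 0 = 0 := exact_sequence_diff 1 exCF.
    have -> : diff (cone a G) 1 *m diff (cone a G) 0 = 0 := exact_sequence_diff 1 exCG.
    by rewrite !mulmx0 !linear0 addr0 !row_mx0.
  move: eq0; set y1 := w *m _; set y2 := u *m _.
  rewrite -!row_mx0 => /eq_row_mx [_ /eq_row_mx [l1 l2]].
  have r1 : rsubmx y1 = 0.
    apply/matrixP => i j; rewrite !ord1 [RHS]mxE; apply: regb.
    have : y1 *m aug (cone b F) = 0 by rewrite -mulmxA dF0 mulmx0.
    rewrite augCF l1 mul0mx add0r => /(congr1 (fun M : 'M_1 => M 0 0)).
    by rewrite mxE [RHS]mxE.
  have r2 : rsubmx y2 = 0.
    apply/matrixP => i j; rewrite !ord1 [RHS]mxE; apply: rega.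
    have : y2 *m aug (cone a G) = 0 by rewrite -mulmxA dG0 mulmx0.
    rewrite augCG l2 mul0mx add0r => /(congr1 (fun M : 'M_1 => M 0 0)).
    by rewrite mxE [RHS]mxE.
  have [|z1 ->] := (exCF 1 w).1; first by rewrite -[LHS]hsubmxK l1 r1 row_mx0.
  have [|z2 ->] := (exCG 1 u).1; first by rewrite -[LHS]hsubmxK l2 r2 row_mx0.
  by exists (row_mx z1 z2); rewrite [RHS]mul_row_block !row_mx0 !mulmx0 add0r addr0.
rewrite [prev_diff _ _]/= mul_row_block !mulmx0 add0r addr0 -row_mx0.
split=> [/eq_row_mx [w0 u0]|[z]].
  have [z1 ->] := (exCF t.+2 w).1 w0.
  have [z2 ->] := (exCG t.+2 u).1 u0.
  by exists (row_mx z1 z2); rewrite mul_row_block !mulmx0 add0r addr0.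
rewrite -[z]hsubmxK [_ *m _]mul_row_block !mulmx0 add0r addr0 => /eq_row_mx [-> ->].
rewrite -!mulmxA.
have -> : diff (cone b F) t.+2 *m diff (cone b F) t.+1 = 0 :=
  exact_sequence_diff t.+2 exCF.
have -> : diff (cone a G) t.+2 *m diff (cone a G) t.+1 = 0 :=
  exact_sequence_diff t.+2 exCG.
by rewrite !mulmx0.
Qed.

End Glue.

Definition quotient_sequence F : free_sequence R :=
  @FreeSequence R (fun t => prev_rk F t) (prev_diff F) 1%:M.

Lemma quotient_resolution (I : R -> Prop) F :
  (forall p, I p <-> aug_image F p) -> exact_sequence F ->
  free_resolution I (quotient_sequence F).
Proof.
move=> IE exF; split=> [p|v|t v]; last exact: exF.
  by exists p%:M; apply/IE; exists 0; rewrite mulmx1 mxE eqxx subrr mul0mx raddf0.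
rewrite [_ *m _]mulmx1 IE; split=> [] [w wE]; exists w.
  by rewrite [LHS]mx11_scalar.
by rewrite -mx11_scalar.
Qed.

End IdealResolutions.

(** * Koszul complexes on variables *)

Section KoszulComplex.
Variables (K : fieldType) (n : nat).
Implicit Types (p q : {mpoly K[n]}) (S : seq 'I_n) (F : free_sequence {mpoly K[n]}).

Definition vars_ideal S := generated_ideal [seq 'X_i : {mpoly K[n]} | i <- S].

(** Setting the variables of [S] to zero is a ring morphism with kernel the
    ideal of [S] ([vars_idealP]), which makes primality of that ideal
    evident. *)
Definition kill S p : {mpoly K[n]} :=
  p \mPo [tuple (if i \in S then 0 else 'X_i) | i < n].

HB.instance Definition _ S := GRing.RMorphism.copy (kill S)
  (@comp_mpoly n K n [tuple (if i \in S then 0 else 'X_i) | i < n]).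

Lemma killX S i : kill S 'X_i = if i \in S then 0 else 'X_i.
Proof. by rewrite /kill comp_mpolyXU -tnth_nth tnth_mktuple. Qed.

(** The polynomials [p] with this property form a subring containing the
    constants and the variables. *)
Lemma sub_kill S p : vars_ideal S (p - kill S p).
Proof.
have idealM q1 q2 : vars_ideal S (q1 - kill S q1) ->
    vars_ideal S (q2 - kill S q2) -> vars_ideal S (q1 * q2 - kill S (q1 * q2)).
  move=> h1 h2; rewrite rmorphM.
  have -> : q1 * q2 - kill S q1 * kill S q2 =
      q2 * (q1 - kill S q1) + kill S q1 * (q2 - kill S q2).
    by rewrite !mulrBr [q2 * q1]mulrC [q2 * _]mulrC addrA subrK.
  by apply: generated_idealD; apply: generated_idealM.
have idealC c : vars_ideal S (c%:MP - kill S c%:MP).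
  by rewrite /kill comp_mpolyC subrr; apply: generated_ideal0.
have idealX i : vars_ideal S ('X_i - kill S 'X_i).
  rewrite killX; case: ifP => iS; last by rewrite subrr; apply: generated_ideal0.
  rewrite subr0.
  have h : (index i S < size [seq 'X_i : {mpoly K[n]} | i <- S])%N.
    by rewrite size_map index_mem.
  exists (fun j => (j == Ordinal h)%:R).
  rewrite (bigD1 (Ordinal h)) //= eqxx mul1r big1 => [|j /negPf ->].
    by rewrite addr0 (nth_map i) ?index_mem // nth_index.
  by rewrite mul0r.
elim/mpolyind: p => [|c m p _ _ IH].
  by rewrite rmorph0 subr0; exact: generated_ideal0.
rewrite rmorphD /= opprD addrACA; apply: generated_idealD => //.
rewrite -mul_mpolyC; apply: (idealM); first exact: (idealC).
rewrite mpolyXE_id.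
apply: (big_ind (fun q => vars_ideal S (q - kill S q))) => [||i _].
- by rewrite -mpolyC1; exact: (idealC).
- exact: (idealM).
elim: (m i) => [|k IHk]; first by rewrite expr0 -mpolyC1; exact: (idealC).
by rewrite exprS; exact: (idealM).
Qed.

Lemma vars_idealP S p : vars_ideal S p <-> kill S p = 0.
Proof.
split=> [[c ->]|pS0]; last by rewrite -[p]subr0 -pS0; exact: sub_kill.
rewrite rmorph_sum big1 // => i _ /=.
have iS : (i < size S)%N by rewrite -(size_map (fun i => 'X_i : {mpoly K[n]})).
pose k := tnth (in_tuple S) (Ordinal iS).
by rewrite rmorphM /= (nth_map k) // killX mem_nth // mulr0.
Qed.

Lemma vars_ideal_nzd k S p :
  k \notin S -> vars_ideal S ('X_k * p) -> vars_ideal S p.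
Proof.
move=> /negPf kS /vars_idealP; rewrite rmorphM /= killX kS => /eqP.
rewrite mulf_eq0 => /orP [|/eqP ?]; last exact/vars_idealP.
by rewrite -msupp_eq0 msuppX.
Qed.

Lemma irrelevant_ideal_eval0 p : irrelevant_ideal p -> p.@[fun=> 0] = 0.
Proof.
case=> c ->; rewrite rmorph_sum big1 // => i _ /=.
have iS : (i < size (enum 'I_n))%N.
  by rewrite -(size_map (fun i => 'X_i : {mpoly K[n]})).
pose k := tnth (in_tuple (enum 'I_n)) (Ordinal iS).
by rewrite mevalM (nth_map k) // mevalXU mulr0.
Qed.

Lemma homog_irrelevant d p : p \is d.+1.-homog -> irrelevant_ideal p.
Proof.
move=> hp; apply/vars_idealP; rewrite [p]mpolyE rmorph_sum big_seq big1 // => m mp /=.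
rewrite /kill comp_mpolyZ comp_mpolyX.
have : mdeg m != 0%N by rewrite (dhomogP _ _ _ hp) //.
rewrite mdegE sum_nat_eq0 negb_forall => /existsP [i /= mi].
by rewrite (bigD1 i) //= tnth_mktuple mem_enum /= expr0n (negPf mi) mul0r scaler0.
Qed.

Definition koszul S := foldr (fun i => cone 'X_i) (nil_sequence {mpoly K[n]}) S.

Lemma koszul_aug_image S p : aug_image (koszul S) p <-> vars_ideal S p.
Proof.
elim: S p => [|k S IH] p.
  split=> [[v]|/generated_ideal_nil ->]; last by exists 0; rewrite mul0mx raddf0.
  rewrite mulmx0 => /(congr1 (fun M : 'M_1 => M 0 0)).
  by rewrite !mxE mulr1n => ->; exact: generated_ideal0.
rewrite cone_aug_image; split=> [[c /IH pS]|/generated_ideal_cons [c pS]].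
  by apply/generated_ideal_cons; exists c.
by exists c; apply/IH.
Qed.

Lemma koszul_exact S : uniq S -> exact_sequence (koszul S).
Proof.
elim: S => [|k S IH] /=; first by move=> _; exact: nil_sequence_exact.
case/andP=> kS /IH exS; apply: cone_exact => // p.
by rewrite !koszul_aug_image; exact: vars_ideal_nzd.
Qed.

Lemma koszul_prev_rk S t : prev_rk (koszul S) t = 'C(size S, t).
Proof.
elim: S t => [|k S IH] [|[|t]] //=.
  by rewrite binS -(IH 1%N) bin0.
by rewrite binS -!IH.
Qed.

(** [F] is a linear resolution generated in degree [d]: every basis vector of
    [F_t] has degree [d + t]. *)
Definition linear d F :=
  (forall i, aug F i 0 \is d.-homog) /\
  (forall t i j, diff F t i j \is 1.-homog).

Lemma cone_linear i F : linear 1 F -> linear 1 (cone 'X_i F).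
Proof.
have Xi : ('X_i : {mpoly K[n]}) \is 1.-homog by rewrite dhomogX /= mdeg1.
case=> augF dF; have bF t : forall j k, prev_diff F t j k \is 1.-homog.
  by case: t => [|t] j k /=; rewrite ?ord1.
split=> [j|t j k]; rewrite /= mxE; case: split => j'.
- exact: augF.
- by rewrite !ord1 mxE mulr1n.
- rewrite mxE; case: split => k'; [exact: dF | rewrite mxE; exact: dhomog0].
- rewrite mxE; case: split => k'; last exact: bF.
  by rewrite mxE; apply: rpredMn; rewrite -[_ ^+ _]signr_odd; case: odd;
    rewrite ?mulN1r ?rpredN ?mul1r.
Qed.

Lemma koszul_linear S : linear 1 (koszul S).
Proof.
elim: S => [|k S IH]; last exact: cone_linear.
by split=> [[]|t []].
Qed.

Lemma glue_linear i k F G :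
  linear 1 F -> linear 1 G -> linear 2 (glue 'X_i 'X_k F G).
Proof.
move=> lF lG.
have Xhom j : ('X_j : {mpoly K[n]}) \is 1.-homog by rewrite dhomogX /= mdeg1.
have [_ dCF] := cone_linear k lF; have [_ dCG] := cone_linear i lG.
case: lF lG => augF _ [augG _].
split=> [j|[|t] j l]; rewrite mxE; case: split => j'.
- by rewrite ord1 mxE mulr1n; apply: (@dhomogM _ _ _ 1 _ 1).
- rewrite mxE; case: split => j''; rewrite mxE; exact: (@dhomogM _ _ _ 1 _ 1).
- rewrite mxE; case: split => l'; first by rewrite mxE; exact: dCF.
  by rewrite mxE; case: split => l''; rewrite mxE; [exact: dCF | exact: dhomog0].
- rewrite mxE; case: split => l'; first by rewrite mxE; exact: dCG.
  by rewrite mxE; case: split => l''; rewrite mxE; [exact: dhomog0 | exact: dCG].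
- by rewrite mxE; case: split => l'; [exact: (dCF t.+1) | rewrite mxE dhomog0].
- by rewrite mxE; case: split => l'; [rewrite mxE dhomog0 | exact: (dCG t.+1)].
Qed.

Lemma quotient_graded d F : linear d F -> graded (quotient_sequence F).
Proof.
case=> augF dF.
exists (fun t _ => if t is u.+1 then (d + u)%N%:Z else 0); split=> [j|t i j].
  by right; exists 0%N => //; rewrite /= mxE ord1 eqxx dhomog1.
right; case: t i j => [|t] i j /=; last exists 1%N => //.
  by exists d; [rewrite addn0 subr0 | rewrite ord1].
by rewrite addnS -addn1 PoszD addrAC subrr add0r.
Qed.

Lemma quotient_minimal d F (I : {mpoly K[n]} -> Prop) :
  linear d.+1 F -> (forall p, I p <-> aug_image F p) -> exact_sequence F ->
  minimal_free_resolution I (quotient_sequence F).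
Proof.
case=> augF dF IE exF; split; first exact: quotient_resolution.
case=> [|t] i j /=; last exact: homog_irrelevant (dF _ _ _).
by rewrite [j]ord1; exact: homog_irrelevant (augF _).
Qed.

Lemma minimal_rank_unique gs F G t :
  minimal_free_resolution (generated_ideal gs) F ->
  minimal_free_resolution (generated_ideal gs) G ->
  rk F t = rk G t.
Proof.
move=> [resF minF] [resG minG].
have ev0 (H : free_sequence {mpoly K[n]}) :
    (forall u i j, irrelevant_ideal (diff H u i j)) ->
    forall u, map_mx (meval (fun=> 0 : K)) (diff H u) = 0.
  by move=> minH u; apply/matrixP => i j; rewrite !mxE; exact: irrelevant_ideal_eval0.
by apply/eqP; rewrite eqn_leq; apply/andP; split;
  [apply: rank_minimal_le resF resG (ev0 _ minF)
  |apply: rank_minimal_le resG resF (ev0 _ minG)].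
Qed.

End KoszulComplex.

(** * The double star *)

Section DoubleStarResolution.
Variables (K : fieldType) (r s : nat).

Let xs := [seq @vx r s i | i <- enum 'I_r].
Let ys := [seq @vy r s j | j <- enum 'I_s].

Definition double_star_sequence : free_sequence {mpoly K[2 + (r + s)]} :=
  glue 'X_(va r s) 'X_(vb r s) (koszul K xs) (koszul K ys).

Let H := double_star_sequence.

Lemma double_star_aug_image p :
  edge_ideal K (double_star r s) p <-> aug_image H p.
Proof.
rewrite glue_aug_image /edge_ideal map_cons map_cat.
have leaves k zs :
    [seq 'X_(e.1) * 'X_(e.2) | e <- [seq (k, z) | z <- zs]] =
    [seq 'X_k * g | g <- [seq 'X_z : {mpoly K[2 + (r + s)]} | z <- zs]].
  by rewrite -!map_comp.
have -> : [seq (va r s, vx s i) | i <- enum 'I_r] = [seq (va r s, z) | z <- xs].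
  by rewrite -[RHS]map_comp.
have -> : [seq (vb r s, vy r j) | j <- enum 'I_s] = [seq (vb r s, z) | z <- ys].
  by rewrite -[RHS]map_comp.
rewrite !leaves generated_ideal_cons; split=> [[c]|[c [q1 [q2 [h1 h2 ->]]]]].
  case/generated_ideal_cat=> _ /generated_ideal_scale [q1 h1 ->].
  case/generated_ideal_scale=> q2 h2 qE; exists c, q1, q2.
  split; [exact/koszul_aug_image | exact/koszul_aug_image |].
  by rewrite -qE (addrC (_ * q1)) subrK addrC subrK.
exists c; rewrite /= [c * _ + _]addrC addrK; apply/generated_ideal_cat.
exists ('X_(va r s) * q1).
  by apply/generated_ideal_scale; exists q1 => //; apply/koszul_aug_image.
rewrite addrC addKr; apply/generated_ideal_scale; exists q2 => //.
exact/koszul_aug_image.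
Qed.

Lemma vab_notin : (va r s \notin xs ++ ys) && (vb r s \notin xs ++ ys).
Proof.
rewrite !mem_cat !negb_or; apply/andP; split; apply/andP; split;
  by apply/negP => /mapP [i _ /(congr1 val)].
Qed.

Lemma double_star_exact : exact_sequence H.
Proof.
have /andP [] := vab_notin; rewrite !mem_cat !negb_or.
case/andP=> axs ays /andP [bxs bys].
have uxs : uniq xs.
  by rewrite map_inj_uniq ?enum_uniq // => i j /rshift_inj /lshift_inj.
have uys : uniq ys.
  by rewrite map_inj_uniq ?enum_uniq // => i j /rshift_inj /rshift_inj.
have Xreg k (p : {mpoly K[2 + (r + s)]}) : 'X_k * p = 0 -> p = 0.
  by move/eqP; rewrite mulf_eq0 -msupp_eq0 msuppX => /eqP.
apply: glue_exact; [exact: Xreg | exact: Xreg | move=> p q pq | |].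
(* Coprimality of [a] and [b]: [a] is a nonzerodivisor modulo [b]. *)
- have : vars_ideal [:: vb r s] p.
    apply: (@vars_ideal_nzd _ _ (va r s)) => //.
    rewrite pq; apply/generated_ideal_cons; exists q.
    by rewrite mulrC subrr; exact: generated_ideal0.
  case/generated_ideal_cons=> c /generated_ideal_nil /eqP.
  by rewrite subr_eq0 mulrC => /eqP; exists c.
- by apply: (@koszul_exact _ _ (vb r s :: xs)); rewrite /= bxs.
- by apply: (@koszul_exact _ _ (va r s :: ys)); rewrite /= ays.
Qed.

Lemma double_star_linear : linear 2 H.
Proof. by apply: glue_linear; exact: koszul_linear. Qed.

Lemma double_star_rank t :
  rk (quotient_sequence H) t =
    if t is 0 then 1%N else if t is 1 then (1 + r + s)%N
    else ('C(r + 1, t) + 'C(s + 1, t))%N.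
Proof.
have rkE zs u : rk (koszul K (zs : seq 'I_(2 + (r + s)))) u = 'C(size zs, u.+1).
  exact: (koszul_prev_rk K zs u.+1).
have sx : size xs = r by rewrite size_map size_enum_ord.
have sy : size ys = s by rewrite size_map size_enum_ord.
case: t => [|[|t]] //.
  change (1 + (rk (koszul K xs) 0 + rk (koszul K ys) 0) = 1 + r + s)%N.
  by rewrite !rkE sx sy !bin1 addnA.
change (rk (koszul K xs) t.+1 + rk (koszul K xs) t +
        (rk (koszul K ys) t.+1 + rk (koszul K ys) t) =
        'C(r + 1, t.+2) + 'C(s + 1, t.+2))%N.
by rewrite !rkE sx sy !addn1 !binS.
Qed.

End DoubleStarResolution.

Theorem proposition8 (K : fieldType) (r s : nat) :
  projective_dimension (edge_ideal K (double_star r s)) (maxn r s + 1) /\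
  forall t : nat, (1 <= t <= maxn r s + 1)%N ->
    betti_number (edge_ideal K (double_star r s)) t
      (if t == 1%N then (1 + r + s)%N
       else ('C(r + 1, t) + 'C(s + 1, t))%N).
Proof.
pose F := quotient_sequence (double_star_sequence K r s).
have minF : minimal_free_resolution (edge_ideal K (double_star r s)) F.
  exact: (quotient_minimal (double_star_linear K r s)
            (@double_star_aug_image K r s) (@double_star_exact K r s)).
have exF : exists2 F,
    minimal_free_resolution (edge_ideal K (double_star r s)) F & graded F.
  by exists F => //; exact: quotient_graded (double_star_linear K r s).
have rkE G : minimal_free_resolution (edge_ideal K (double_star r s)) G ->
    forall t, rk G t = rk F t.
  by move=> minG t; exact: minimal_rank_unique minG minF.
split=> [|t /andP [t1 _]]; split=> // G /rkE rkG; first split=> [|t lt].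
(* For [r = s = 0] the last module is [F_1], whose rank has the separate form
   [1 + r + s]; otherwise the larger of [r] and [s] gives a binomial 1. *)
- rewrite rkG double_star_rank addn1; case mE : (maxn r s) => [|m] //.
  rewrite !addn1 addn_gt0 !bin_gt0 !ltnS -mE.
  by case/orP: (leq_total r s) => rs; rewrite ?(maxn_idPr rs) ?(maxn_idPl rs) leqnn ?orbT.
- rewrite rkG double_star_rank; move: lt; rewrite addn1.
  case: t => [|[|t]] //.
  by rewrite !ltnS geq_max => /andP [rt st]; rewrite !bin_small // addn1 !ltnS.
by rewrite rkG double_star_rank; case: t t1 => [|[|t]].
Qed.
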